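(* There is a deterministic simultaneous algorithm for combinatorial auctions with $m$ items and $n$ subadditive bidders, where each player sends $\mathrm{poly}(m,n)$ bits, that guarantees an approximation ratio of $\tilde O(m^{\frac13})$.
   Context: Combinatorial auction: a set $M$ of $m$ items and $n$ bidders (players); bidder $i$ has a valuation $v_i:2^M\to\mathbb{R}$ that is normalized ($v_i(\emptyset)=0$) and non-decreasing. It is subadditive if $v_i(S\cup T)\le v_i(S)+v_i(T)$ for all bundles $S,T$. An allocation $(A_1,\dots,A_n)$ consists of disjoint subsets of $M$; its social welfare is $\sum_i v_i(A_i)$, and $OPT$ is the maximum social welfare. In a deterministic simultaneous algorithm each bidder $i$, simultaneously with the others, sends one message, a function of $v_i$ only, to a central planner, who outputs an allocation based only on the messages. The approximation ratio is $c$ if on every input the social welfare of the output is at least $OPT/c$. $\tilde O(\cdot)$ hides factors poly-logarithmic in $m$.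
   Formalization: Over arbitrary real valuations no finite number of bits suffices (one item, two bidders), so each player sends at most poly(m,n)·(b+1) bits when all nonzero values of its valuation lie in [2^-b, 2^b]; the algorithm does not know b and the approximation ratio does not depend on it. *)

(* Defs.v *)
From mathcomp Require Import all_boot all_order all_algebra.
From mathcomp Require Import reals exp.

Set Implicit Arguments.
Unset Strict Implicit.
Unset Printing Implicit Defensive.

Import Order.TTheory GRing.Theory Num.Theory.
Local Open Scope ring_scope.

Section Auctions.
Variables (R : realType) (m n : nat).

Definition valuation (v : {set 'I_m} -> R) : Prop :=
  v set0 = 0 /\ forall S T : {set 'I_m}, S \subset T -> v S <= v T.

Definition subadditive_valuation (v : {set 'I_m} -> R) : Prop :=
  valuation v /\ forall S T : {set 'I_m}, v (S :|: T) <= v S + v T.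

(* Items may be left unallocated. *)
Definition is_allocation (A : {ffun 'I_n -> {set 'I_m}}) : bool :=
  [forall i, forall j, (i != j) ==> [disjoint A i & A j]].

Definition welfare (v : 'I_n -> {set 'I_m} -> R)
    (A : {ffun 'I_n -> {set 'I_m}}) : R :=
  \sum_(i < n) v i (A i).

(* The default value 0 of the maximum is the welfare of the empty allocation,
   since valuations are normalized. *)
Definition OPT (v : 'I_n -> {set 'I_m} -> R) : R :=
  \big[Num.max/0]_(A : {ffun 'I_n -> {set 'I_m}} | is_allocation A)
    welfare v A.

(* The message of bidder i depends on its own valuation only, and the planner
   sees nothing but the messages. *)
Record simultaneous_algorithm := SimultaneousAlgorithm {
  message : 'I_n -> ({set 'I_m} -> R) -> seq bool;
  planner : ('I_n -> seq bool) -> {ffun 'I_n -> {set 'I_m}};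
  planner_allocation : forall t, is_allocation (planner t)
}.

Definition outcome (alg : simultaneous_algorithm)
    (v : 'I_n -> {set 'I_m} -> R) : {ffun 'I_n -> {set 'I_m}} :=
  planner alg (fun i => message alg i (v i)).

(* Positivity of c is required because x / 0 = 0. *)
Definition subadditive_approximation_ratio (alg : simultaneous_algorithm)
    (c : R) : Prop :=
  0 < c /\
  forall v : 'I_n -> {set 'I_m} -> R,
    (forall i, subadditive_valuation (v i)) ->
    OPT v / c <= welfare v (outcome alg v).

(* Every nonzero value has a magnitude of at most b bits. For instance, this
   holds if all values are integers between 0 and 2 ^ b, or quotients of
   integers between 0 and 2 ^ b. *)
Definition magnitude_bits (b : nat) (v : {set 'I_m} -> R) : Prop :=
  forall S : {set 'I_m}, v S = 0 \/ 2 ^- b <= v S <= 2 ^+ b.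

(* Finitely many messages cannot locate real values of unbounded scale: with
   a single item and two bidders, no finite message space gives any finite
   ratio. The bits spent on the magnitude of the values are therefore accounted
   for by the factor b.+1, and L bounds the message length per bit of
   magnitude. The algorithm itself does not know b. *)
Definition sends_bits (alg : simultaneous_algorithm) (L : nat) : Prop :=
  forall (i : 'I_n) (v : {set 'I_m} -> R) (b : nat),
    subadditive_valuation v -> magnitude_bits b v ->
    (size (message alg i v) <= L * b.+1)%N.

End Auctions.

Definition polynomially_bounded (L : nat -> nat -> nat) : Prop :=
  exists a d : nat, forall m n : nat, (L m n <= a * (m + n).+1 ^ d)%N.

(* f(m) is in soft-O of g(m), with factors polylogarithmic in m hidden. *)
Definition softO (R : realType) (f g : nat -> R) : Prop :=
  exists (C : R) (k N : nat), forall m : nat, (N <= m)%N ->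
    `|f m| <= C * `|g m| * ln (m%:R : R) ^+ k.

(* Main.v *)
(* Call a bundle D dense at price p for a valuation v if v W >= p |W| for every
   part W of D. Every bundle O contains some D dense at p such that p |D| is
   v O up to a logarithmic factor. For every price p on a dyadic grid around
   v M, and every size k, a bidder reports a maximal family of disjoint bundles
   of size k dense at p. These reports are lower bounds on the valuation, and
   the planner maximizes the welfare they guarantee.

   Let D_i be the dense part of the optimal bundle O_i and k_i half its size.
   By maximality the reported bundles of size k_i cover half of D_i. With
   t ~ m^(1/3), and up to logarithms, a 1/t fraction of the optimum is
   guaranteed by one of three allocations. If most D_i have at most t items,
   give each bidder a single item. If most reported families have at most t
   bundles, give each bidder D_i, as one of these bundles contains a 1/(2t)
   fraction of D_i. Otherwise there are at most about m / t <= t^2 bidders, and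
   t / 2 of them can be served greedily with half of a reported bundle each: of
   more than t disjoint bundles, one loses at most half to the items already
   given away. *)
Require Import Defs.
From mathcomp Require Import all_boot all_order all_algebra.
From mathcomp Require Import reals exp.
From mathcomp Require Import zify ring lra.

Set Implicit Arguments.
Unset Strict Implicit.
Unset Printing Implicit Defensive.

Import Order.TTheory GRing.Theory Num.Theory.
Local Open Scope ring_scope.

(** * Harmonic numbers *)

Section Harmonic.
Variable R : realType.

Definition harmonic (n : nat) : R := \sum_(i < n) i.+1%:R^-1.

Lemma harmonicS n : harmonic n.+1 = harmonic n + n.+1%:R^-1.
Proof. by rewrite /harmonic big_ord_recr. Qed.

Lemma harmonic_ge0 n : 0 <= harmonic n.
Proof. by apply: sumr_ge0 => i _; rewrite invr_ge0 ler0n. Qed.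

Lemma harmonic_ge1 n : (0 < n)%N -> 1 <= harmonic n.
Proof.
case: n => // n _; rewrite /harmonic big_ord_recl /= invr1 lerDl.
by apply: sumr_ge0 => i _; rewrite invr_ge0 ler0n.
Qed.

Lemma harmonic_le_nat n : harmonic n <= n%:R.
Proof.
elim: n => [|n IH]; first by rewrite /harmonic big_ord0.
by rewrite harmonicS -[leRHS]natr1 lerD // invf_le1 ?ltr0n // ler1n.
Qed.

(** Each of the [d] added terms is at least [1 / (n + d)]. *)
Lemma harmonic_sub (n d : nat) :
  harmonic n + d%:R / (n + d)%:R <= harmonic (n + d).
Proof.
elim: d => [|d IH]; first by rewrite addn0 mul0r addr0.
rewrite addnS harmonicS.
have h : d%:R / (n + d).+1%:R <= d%:R / (n + d)%:R :> R.
  case: d {IH} => [|d]; first by rewrite !mul0r.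
  by rewrite ler_wpM2l ?ler0n // lef_pV2 ?posrE ?ltr0n ?addnS // ler_nat.
rewrite -[d.+1%:R]natr1 mulrDl mul1r addrA lerD2r.
by apply: le_trans IH; rewrite lerD2l.
Qed.

Lemma harmonic_homo : {homo harmonic : n k / (n <= k)%N >-> n <= k}.
Proof.
move=> n k /subnKC <-; apply: le_trans (harmonic_sub _ _).
by rewrite lerDl divr_ge0 ?ler0n.
Qed.

(** The inequality [ln (1 + x) <= x] at [x = - 1 / (n + 2)]. *)
Lemma ln_succ_sub (n : nat) :
  n.+2%:R^-1 <= ln n.+2%:R - ln n.+1%:R :> R.
Proof.
have p1 : (0 : R) < n.+1%:R by rewrite ltr0n.
have p2 : (0 : R) < n.+2%:R by rewrite ltr0n.
have e : n.+1%:R / n.+2%:R = 1 + (- n.+2%:R^-1) :> R.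
  apply: (mulIf (lt0r_neq0 p2)).
  by rewrite mulrDl mulNr mulVf ?divfK ?lt0r_neq0 // mul1r -[n.+2%:R]natr1 addrK.
have h : ln (n.+1%:R / n.+2%:R) <= - n.+2%:R^-1 :> R.
  rewrite e; apply: le_ln1Dx; rewrite ltrN2 invf_lt1 // ltr1n //.
move: h; rewrite ln_div ?posrE //; by rewrite -lerN2 opprK opprB.
Qed.

Lemma ln_ge_half (n : nat) : (2 <= n)%N -> 2^-1 <= ln n%:R :> R.
Proof.
move=> n2; apply: (@le_trans _ _ (ln 2%:R)).
  by have := ln_succ_sub 0; rewrite ln1 subr0.
by rewrite ler_ln ?posrE ?ltr0n ?ler_nat //; lia.
Qed.

Lemma harmonic_le_ln (n : nat) : (0 < n)%N -> harmonic n <= 1 + ln n%:R.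
Proof.
elim: n => // -[|n] IH _; first by rewrite /harmonic big_ord1 ln1 addr0 invr1.
rewrite harmonicS; apply: le_trans (lerD (IH isT) (ln_succ_sub n)) _.
by rewrite -addrA (addrC (ln _)) subrK.
Qed.

(** By the second hypothesis the r-th largest value is at most [c / r]. The induction removes a
    minimum, for which the counted set is all of [A]; the other counts can only shrink. *)
Lemma sum_le_harmonic (I : finType) (A : {set I}) (f : I -> R) (c : R) :
    (forall j, j \in A -> 0 <= f j) ->
    (forall j, j \in A -> f j * #|[set i in A | f j <= f i]|%:R <= c) ->
  \sum_(i in A) f i <= c * harmonic #|A|.
Proof.
move: {2}#|A| (erefl #|A|) => n; elim: n A => [|n IH] A cA f0 hA.
  by rewrite (cards0_eq cA) cards0 big_set0 /harmonic big_ord0 mulr0.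
have [a0 a0A] : exists a0, a0 \in A by apply/set0Pn; rewrite -card_gt0 cA.
case: (@Order.TotalTheory.arg_minP _ _ _ a0 [in A] f a0A) => a aA amin.
have cA' : #|A :\ a| = n by have := cardsD1 a A; rewrite aA cA; lia.
rewrite (big_setD1 a) //= cA harmonicS mulrDr addrC lerD //.
  rewrite -cA'; apply: IH => // j; rewrite !inE => /andP[ja jA].
    exact: f0.
  apply: le_trans (hA _ jA); rewrite ler_wpM2l ?f0 // ler_nat subset_leq_card //.
  by apply/subsetP => i; rewrite !inE => /andP[/andP[_ ->] ->].
rewrite ler_pdivlMr ?ltr0n // -{1}cA.
suff -> : #|A| = #|[set i in A | f a <= f i]| by apply: hA.
by apply: eq_card => i; rewrite !inE andb_idr // => /amin.
Qed.

End Harmonic.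

(** * Dense bundles *)

Section Density.
Variables (R : realType) (m : nat) (v : {set 'I_m} -> R).
Hypothesis subadd : subadditive_valuation v.

Lemma valuation_ge0 S : 0 <= v S.
Proof. by case: subadd => -[<- h] _; apply: h; apply: sub0set. Qed.

Definition dense (p : R) (D : {set 'I_m}) : bool :=
  [forall W : {set 'I_m}, (W \subset D) ==> (p * #|W|%:R <= v W)].

Lemma denseP p (D : {set 'I_m}) :
  reflect (forall W : {set 'I_m}, W \subset D -> p * #|W|%:R <= v W)
          (dense p D).
Proof.
apply: (iffP forallP) => h W; first exact/implyP.
by apply/implyP; apply: h.
Qed.

Lemma dense0 p : dense p set0.
Proof.
apply/denseP => W; rewrite subset0 => /eqP ->.
by rewrite cards0 mulr0 valuation_ge0.
Qed.

Lemma sub_dense p (D D' : {set 'I_m}) : D' \subset D -> dense p D -> dense p D'.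
Proof.
by move=> sD /denseP h; apply/denseP => W sW; apply: h; apply: subset_trans sD.
Qed.

Lemma le_dense p p' D : p' <= p -> dense p D -> dense p' D.
Proof.
move=> le_p /denseP h; apply/denseP => W /h; apply: le_trans.
by rewrite ler_wpM2r ?ler0n.
Qed.

(* A set without dense subsets can be exhausted by repeatedly removing a part
   that is cheap for its size. *)
Lemma exists_dense (O : {set 'I_m}) (c : R) :
    O != set0 -> c * harmonic R #|O| <= v O ->
  exists D : {set 'I_m}, [/\ D \subset O, D != set0 & dense (c / #|D|%:R) D].
Proof.
move=> O0 cO.
have [/existsP[D /and3P[? ? ?]]|/existsPn nD] := boolP [exists D : {set 'I_m},
  [&& D \subset O, D != set0 & dense (c / #|D|%:R) D]]; first by exists D.
suff : v O < c * harmonic R #|O| by rewrite ltNge cO.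
have [n le_n] := ubnP #|O|; elim: n O O0 le_n nD {cO} => // n IH O O0 le_n nD.
(* Since [O] itself is not dense at [c / #|O|], some part [W] has [v W < c * #|W| / #|O|]. By
   [harmonic_sub], removing [W] lowers the harmonic bound by at least this amount. *)
have := nD O; rewrite subxx O0 /= => /forallPn[W].
rewrite negb_imply -ltNge => /andP[sWO vW].
have Op : (0 : R) < #|O|%:R by rewrite ltr0n card_gt0.
have W0 : W != set0.
  apply: contraTneq vW => ->; rewrite cards0 mulr0.
  by case: subadd => -[-> _] _; rewrite ltxx.
have Wp : (0 : R) < #|W|%:R by rewrite ltr0n card_gt0.
have c0 : 0 <= c.
  rewrite leNgt; apply/negP => c_lt0.
  have := le_lt_trans (valuation_ge0 W) vW.
  by rewrite pmulr_lgt0 // pmulr_lgt0 ?invr_gt0 // ltNge ltW.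
have cOE : #|O| = (#|O :\: W| + #|W|)%N.
  by rewrite -(cardsID W O) (setIidPr sWO) addnC.
have vOW : v (O :\: W) <= c * harmonic R #|O :\: W|.
  have [->|OW0] := eqVneq (O :\: W) set0.
    case: subadd => -[-> _] _.
    by rewrite mulr_ge0 ?harmonic_ge0.
  apply: ltW; apply: IH => //.
    by move: W0 le_n; rewrite -card_gt0 cOE; lia.
  move=> D; apply: contra (nD D) => /and3P[sD -> ->].
  by rewrite (subset_trans sD) ?subsetDl.
have vO : v O <= v W + v (O :\: W).
  by rewrite -{1}(setID O W) (setIidPr sWO); apply: (proj2 subadd).
apply: le_lt_trans vO _.
have := harmonic_sub R #|O :\: W| #|W|; rewrite -cOE => hs.
apply: lt_le_trans (ler_wpM2l c0 hs); rewrite mulrDr [ltRHS]addrC.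
by apply: ltr_leD => //; rewrite mulrA mulrAC.
Qed.

(** * Maximal packings of dense bundles *)

Definition dense_packing (p : R) (k : nat) (P : {set {set 'I_m}}) : bool :=
  trivIset P && [forall D in P, dense p D && (#|D| == k)].

Definition packing (p : R) (k : nat) : {set {set 'I_m}} :=
  [arg max_(P > set0 | dense_packing p k P) #|P|].

Lemma packing_spec p k :
  extremum_spec geq (dense_packing p k) (fun P : {set {set 'I_m}} => #|P|)
    (packing p k).
Proof.
apply: arg_maxnP; apply/andP; split.
  by apply/trivIsetP => A B; rewrite inE.
by apply/forall_inP => D; rewrite inE.
Qed.

Lemma packingP p k : dense_packing p k (packing p k).
Proof. by case: packing_spec. Qed.

Lemma trivIset_packing p k : trivIset (packing p k).
Proof. by case/andP: (packingP p k). Qed.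

Lemma packing_dense p k D : D \in packing p k -> dense p D.
Proof. by case/andP: (packingP p k) => _ /forall_inP h /h /andP[]. Qed.

Lemma card_packing p k D : D \in packing p k -> #|D| = k.
Proof. by case/andP: (packingP p k) => _ /forall_inP h /h /andP[_ /eqP]. Qed.

(** For an uncovered item [pblock] defaults to [set0], which is dense as well, so every index yields
    a bundle that is safe to report. *)
Lemma dense_pblock_packing p k x : dense p (pblock (packing p k) x).
Proof.
have [/pblock_mem/packing_dense//|nx] := boolP (x \in cover (packing p k)).
suff -> : pblock (packing p k) x = set0 by apply: dense0.
by apply/eqP/negPn/negP => /set0Pn[y yx]; move: nx; rewrite -mem_pblock;
   rewrite /pblock in yx *; case: pickP yx => [B /andP[_ ->]|]; rewrite ?inE.
Qed.

(** Otherwise [k] uncovered items of [D] would form a dense bundle disjoint from the packing, and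
    adding it would contradict maximality. Positivity of [k] keeps [set0] out of the packing. *)
Lemma card_setD_cover_packing p k (D : {set 'I_m}) :
  (0 < k)%N -> dense p D -> (#|D :\: cover (packing p k)| < k)%N.
Proof.
move=> k0 dD; rewrite ltnNge; apply/negP => /card_geqP[s [us ss sD]].
case: packing_spec (trivIset_packing p k) sD => P packP maxP tP sD.
pose S := [set x in s].
have cS : #|S| = k by rewrite cardsE (card_uniqP us).
have sS : S \subset D :\: cover P by apply/subsetP => x; rewrite inE => /sD.
have PP B : B \in P -> dense p B /\ #|B| = k.
  by case/andP: packP => _ /forall_inP h /h /andP[? /eqP].
have [|||tSP nSP] := @trivIsetU1 _ S P.
- move=> B BP; apply: disjointWl sS _; rewrite disjoint_sym.
  apply: disjointWl (bigcup_sup _ BP) _.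
  by rewrite disjoints_subset setCD subsetUr.
- by [].
- by apply/negP => /PP[_]; rewrite cards0; lia.
suff /maxP : dense_packing p k (S |: P) by rewrite cardsU1 nSP add1n /= ltnn.
apply/andP; split => //; apply/forall_inP => B /setU1P[->|/PP[-> ->]]; last by rewrite eqxx.
by rewrite cS eqxx andbT; apply: sub_dense dD; apply: subset_trans sS (subsetDl _ _).
Qed.

End Density.

(** * Sharing dense bundles among bidders *)

Lemma leq_card_bigcup (I T : finType) (J : {set I}) (A : I -> {set T}) :
  (#|\bigcup_(j in J) A j| <= \sum_(j in J) #|A j|)%N.
Proof.
elim/big_rec2: _ => [|j a b _ h]; first by rewrite cards0.
by apply: leq_trans (leq_card_setU _ _) _; rewrite leq_add2l.
Qed.

(** Double counting: an element of [Y] lies in at most one [A i]. *)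
Lemma sum_card_disjoint (I T : finType) (J : {set I}) (A : I -> {set T})
    (Y : {set T}) :
    (forall i j, i \in J -> j \in J -> i != j -> [disjoint A i & A j]) ->
  (\sum_(i in J) #|A i :&: Y| <= #|Y|)%N.
Proof.
move=> dA.
have cI i : #|A i :&: Y| = (\sum_(y in Y) (y \in A i))%N.
  transitivity (\sum_(y in Y | y \in A i) 1)%N; last first.
    by rewrite big_mkcondr /=; apply: eq_bigr => y _; case: (y \in A i).
  by rewrite -sum1_card; apply: eq_bigl => y; rewrite inE andbC.
under eq_bigr do rewrite cI.
rewrite exchange_big /= -sum1_card; apply: leq_sum => y _.
have -> : (\sum_(i in J) (y \in A i) = #|[set i in J | y \in A i]|)%N.
  transitivity (\sum_(i in J | y \in A i) 1)%N.
    by rewrite big_mkcondr /=; apply: eq_bigr => i _; case: (y \in A i).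
  by rewrite -sum1_card; apply: eq_bigl => i; rewrite inE.
apply/card_le1_eqP => i j; rewrite !inE => /andP[iJ yi] /andP[jJ yj].
apply/eqP/negPn/negP => ij; have /pred0P/(_ y) := dA j i jJ iJ ij.
by rewrite /= yi yj.
Qed.

(** Averaging: the least overlap with [Y] is at most the mean overlap, and overlaps of disjoint sets
    sum to at most [#|Y|]. *)
Lemma exists_small_part (T : finType) (P : {set {set T}}) (Y : {set T}) :
    trivIset P -> (0 < #|P|)%N ->
  exists2 S, S \in P & (#|P| * #|S :&: Y| <= #|Y|)%N.
Proof.
move=> /trivIsetP tP /card_gt0P[S0 S0P].
have [S SP minS] := @arg_minnP _ S0 [in P] (fun S => #|S :&: Y|) S0P.
exists S => //; rewrite -sum_nat_const.
by apply: leq_trans (sum_card_disjoint Y tP); apply: leq_sum.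
Qed.

Lemma exists_large_part (T : finType) (P : {set {set T}}) (Y : {set T}) :
    (0 < #|P|)%N ->
  exists2 S, S \in P & (#|Y :&: cover P| <= #|P| * #|Y :&: S|)%N.
Proof.
move=> /card_gt0P[S0 S0P].
have [S SP maxS] := @arg_maxnP _ S0 [in P] (fun S => #|Y :&: S|) S0P.
exists S => //; rewrite -sum_nat_const /cover big_distrr /=.
by apply: leq_trans (leq_card_bigcup _ _) _; apply: leq_sum.
Qed.

Section Sharing.
Variables (R : realType) (m n : nat).
Variables (w : 'I_n -> {set 'I_m} -> R) (B : R).
Hypothesis w_ge0 : forall i S, 0 <= w i S.
Hypothesis welfareB :
  forall A : {ffun 'I_n -> {set 'I_m}}, is_allocation A -> welfare w A <= B.

(** All lower bounds on [B] below go through the allocation that serves [J] from [A] and leaves the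
    other bidders empty. *)
Lemma card_mul_le_welfare (J : {set 'I_n}) (A : 'I_n -> {set 'I_m}) (g : R) :
    (forall i j, i \in J -> j \in J -> i != j -> [disjoint A i & A j]) ->
    (forall i, i \in J -> g <= w i (A i)) ->
  g * #|J|%:R <= B.
Proof.
move=> dA gA.
pose A' := [ffun i => if i \in J then A i else set0].
have aA' : is_allocation A'.
  apply/forallP => i; apply/forallP => j; apply/implyP => ij; rewrite !ffunE.
  case: ifP => iJ; last by rewrite -setI_eq0 set0I.
  case: ifP => jJ; last by rewrite -setI_eq0 setI0.
  exact: dA.
apply: le_trans (welfareB aA'); rewrite /welfare mulr_natr -sumr_const.
rewrite big_mkcond /=; apply: ler_sum => i _; rewrite ffunE.
by case: ifP => // /gA.
Qed.

Section Greedy.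
Variables (P : 'I_n -> {set {set 'I_m}}) (k : 'I_n -> nat) (t : nat).

(* The bidders are served in increasing order of the size of their bundles, so
   that bidder i loses at most k i items to each bidder served earlier. *)
Lemma exists_disjoint_half_parts (J : {set 'I_n}) :
    (forall i, i \in J -> trivIset (P i)) ->
    (forall i T, i \in J -> T \in P i -> #|T| = k i) ->
    (forall i, i \in J -> (t < #|P i|)%N) ->
    (#|J|.-1.*2 <= t)%N ->
  exists A : 'I_n -> {set 'I_m},
    (forall i j, i \in J -> j \in J -> i != j -> [disjoint A i & A j]) /\
    (forall i, i \in J -> (#|A i| <= k i <= #|A i|.*2)%N /\
      exists2 T, T \in P i & A i \subset T).
Proof.
move: {2}#|J| (erefl #|J|) => s; elim: s J => [|s IH] J cJ tP kP tJ sJ.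
  exists (fun=> set0); split => [i j|i]; rewrite (cards0_eq cJ) inE //.
have [i0 i0J] : exists i, i \in J by apply/set0Pn; rewrite -card_gt0 cJ.
(* The bidder with the largest bundles is served last, after the induction has served the others. *)
have [i iJ imax] := @arg_maxnP _ i0 [in J] k i0J.
have cJ' : #|J :\ i| = s by have := cardsD1 i J; rewrite iJ cJ; lia.
have sub j : j \in J :\ i -> j \in J by case/setD1P.
have [| | | |A [dA hA]] := IH (J :\ i) cJ'.
- by move=> j /sub; apply: tP.
- by move=> j T /sub; apply: kP.
- by move=> j /sub; apply: tJ.
- by move: sJ; rewrite cJ' cJ; lia.
pose Y := \bigcup_(j in J :\ i) A j.
have cY : (#|Y| <= s * k i)%N.
  rewrite -cJ' -sum_nat_const.
  apply: leq_trans (leq_card_bigcup _ _) _.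
  apply: leq_sum => j jJ; have [/andP[h _] _] := hA j jJ.
  exact: leq_trans h (imax _ (sub _ jJ)).
have [|T TP hT] := exists_small_part Y (tP i iJ).
  exact: leq_trans (tJ i iJ).
exists (fun j => if j == i then T :\: Y else A j); split => [j1 j2 h1 h2|j jJ].
  have dY j : j \in J -> j != i -> [disjoint T :\: Y & A j].
    move=> jJ ji; rewrite disjoint_sym; apply: disjointWl (_ : A j \subset Y) _.
      by apply: (bigcup_sup j); rewrite // !inE ji.
    by rewrite disjoints_subset setCD subsetUr.
  move=> h12; case: (eqVneq j1 i) => [e1|n1]; case: (eqVneq j2 i) => [e2|n2].
  - by rewrite e1 e2 eqxx in h12.
  - exact: dY.
  - by rewrite disjoint_sym; apply: dY.
  - by apply: dA => //; rewrite !inE ?n1 ?n2.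
case: eqVneq => [->|ji]; last by apply: hA; rewrite !inE ji.
split; last by exists T => //; apply: subsetDl.
have := cardsID Y T; rewrite (kP i T iJ TP) => e.
(* [Y] has at most [s * k i] items and [P i] has at least [2 * s] bundles, so [T] loses at most half
   of its [k i] items. *)
have h : (#|P i| * #|T :&: Y| <= s * k i)%N by apply: leq_trans cY.
have hp := tJ i iJ; have s2 : (s.*2 <= #|P i|)%N by move: sJ; rewrite cJ; lia.
have : (#|T :&: Y|.*2 <= k i)%N.
  have : (#|P i| * #|T :&: Y|.*2 <= #|P i| * k i)%N.
    by have := leq_mul2r (k i) s.*2 #|P i|; rewrite s2 orbT -!muln2; nia.
  by rewrite leq_pmul2l //; apply: leq_ltn_trans hp.
lia.
Qed.

End Greedy.

(** All bidders of [I] share one value threshold [theta], so that it is enough to count them. [tau]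
    stands for the cube root of [m], rounded up. *)
Variables (theta : R) (tau : nat) (I : {set 'I_n}) (D : 'I_n -> {set 'I_m}).
Variables (p : 'I_n -> R) (P : 'I_n -> {set {set 'I_m}}) (k : 'I_n -> nat).
Hypotheses (tau_gt0 : (0 < tau)%N) (m_le : (m <= tau ^ 3)%N).
Hypothesis disjD :
  forall i j, i \in I -> j \in I -> i != j -> [disjoint D i & D j].
Hypothesis D_neq0 : forall i, i \in I -> D i != set0.
Hypothesis p_ge0 : forall i, i \in I -> 0 <= p i.
Hypothesis theta_le : forall i, i \in I -> theta <= 2 * (p i * #|D i|%:R).
Hypothesis w_item : forall i x, i \in I -> x \in D i -> p i <= w i [set x].
Hypothesis trivP : forall i, i \in I -> trivIset (P i).
Hypothesis cardP : forall i T, i \in I -> T \in P i -> #|T| = k i.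
Hypothesis cardD_le : forall i, i \in I -> (#|D i| <= 2 * k i)%N.
Hypothesis coverD :
  forall i, i \in I -> (#|D i| <= 2 * #|D i :&: cover (P i)|)%N.
Hypothesis w_bundle : forall i T S, i \in I -> T \in P i ->
  p i * #|S :&: T|%:R <= w i S.

Let B_ge0 : 0 <= B.
Proof.
by have := @card_mul_le_welfare set0 D 0; rewrite mul0r; apply => i; rewrite inE.
Qed.

Let tauR_gt0 : 0 < tau%:R :> R.
Proof. by rewrite ltr0n. Qed.

(** A single item of [D i] gets a bid of at least [p i], and [theta <= 2 * p i * tau] when [D i] has
    at most [tau] items. *)
Lemma small_demand_bound :
  theta * #|[set i in I | #|D i| <= tau]%N|%:R <= 2 * tau%:R * B.
Proof.
rewrite -ler_pdivrMl ?mulr_gt0 // mulrA.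
pose A i := if [pick x in D i] is Some x then [set x] else set0.
apply: (card_mul_le_welfare (A := A)) => [i j|i].
  rewrite !inE => /andP[iI _] /andP[jI _] ij.
  rewrite -setI_eq0 -subset0 -(eqP (_ : D i :&: D j == set0)); last first.
    by rewrite setI_eq0 disjD.
  have sA l : A l \subset D l.
    by rewrite /A; case: pickP => [x xD|_]; rewrite ?sub1set ?sub0set.
  by rewrite setISS.
rewrite inE => /andP[iI cD]; rewrite /A; case: pickP => [x xD|D0]; last first.
  by case/set0Pn: (D_neq0 iI) => x; have := D0 x; rewrite /= => ->.
apply: le_trans (w_item iI xD).
rewrite mulrC ler_pdivrMr ?mulr_gt0 //.
apply: le_trans (theta_le iI) _.
rewrite mulrCA ler_wpM2l ?p_ge0 // ler_pM2l // ler_nat //.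
Qed.

(** Each bidder gets all of [D i]. At most [tau] bundles cover half of it, so one of them contains a
    [1 / (2 * tau)] fraction; the other factor 2 is that of [theta_le]. *)
Lemma small_packing_bound :
  theta * #|[set i in I | #|P i| <= tau]%N|%:R <= 4 * tau%:R * B.
Proof.
rewrite -ler_pdivrMl ?mulr_gt0 // mulrA.
apply: (card_mul_le_welfare (A := D)) => [i j|i].
  by rewrite !inE => /andP[iI _] /andP[jI _]; apply: disjD.
rewrite inE => /andP[iI cP].
have cD : (0 < #|D i|)%N by rewrite card_gt0 D_neq0.
have P0 : (0 < #|P i|)%N.
  rewrite card_gt0; apply: contraTneq (coverD iI) => ->.
  by rewrite /cover big_set0 setI0 cards0 muln0 -ltnNge.
have [T TP hT] := exists_large_part (D i) P0.
apply: le_trans (w_bundle _ iI TP).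
rewrite mulrC ler_pdivrMr ?mulr_gt0 //.
apply: le_trans (theta_le iI) _.
rewrite mulrCA -mulrA ler_wpM2l ?p_ge0 //.
suff : (2 * #|D i| <= #|D i :&: T| * (4 * tau))%N by rewrite -(ler_nat R) !natrM.
have := coverD iI; nia.
Qed.

Lemma large_packing_bound :
  theta * #|[set i in I | (tau < #|D i|) && (tau < #|P i|)]%N|%:R
    <= 16 * tau%:R * B.
Proof.
set J := [set _ in _ | _].
have JI i : i \in J -> [/\ i \in I, (tau < #|D i|)%N & (tau < #|P i|)%N].
  by rewrite inE => /andP[? /andP[? ?]].
have [th0|th0] := ltP theta 0.
  apply: (@le_trans _ _ 0); first by rewrite mulr_le0_ge0 ?ler0n // ltW.
  by rewrite !mulr_ge0.
(* Disjoint parts with more than [tau] items each share [m <= tau ^ 3] items. *)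
have cJ : (#|J| <= tau ^ 2)%N.
  have : (#|J| * tau <= tau ^ 2 * tau)%N.
    rewrite -expnSr; apply: leq_trans m_le; rewrite -sum_nat_const.
    rewrite -[m in leqRHS]card_ord -cardsT.
    apply: leq_trans (sum_card_disjoint [set: 'I_m] (A := D) (J := J) _).
      by apply: leq_sum => i /JI[_ h _]; rewrite setIT ltnW.
    by move=> i j /JI[iI _ _] /JI[jI _ _]; apply: disjD.
  by rewrite leq_pmul2r.
(* The constant 8 comes from [theta <= 2 * p i * #|D i| <= 4 * p i * k i <= 8 * p i * #|A i|]. *)
have served (J' : {set 'I_n}) : J' \subset J -> (#|J'|.-1.*2 <= tau)%N ->
    theta * #|J'|%:R <= 8 * B.
  move=> /subsetP sJ cJ'; rewrite -ler_pdivrMl // mulrA.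
  have [| | |//|A [dA hA]] := @exists_disjoint_half_parts P k tau J'.
  - by move=> i /sJ/JI[iI _ _]; apply: trivP.
  - by move=> i T /sJ/JI[iI _ _]; apply: cardP.
  - by move=> i /sJ/JI[].
  apply: (card_mul_le_welfare dA) => i iJ'.
  have [/andP[_ kA] [T TP sAT]] := hA i iJ'; have [iI _ _] := JI i (sJ i iJ').
  have := w_bundle (A i) iI TP; rewrite (setIidPl sAT); apply: le_trans.
  rewrite mulrC ler_pdivrMr //; apply: le_trans (theta_le iI) _.
  rewrite mulrCA -mulrA ler_wpM2l ?p_ge0 // -!natrM ler_nat.
  have := cardD_le iI; lia.
have [small|big] := leqP #|J|.-1.*2 tau.
  apply: le_trans (served J (subxx _) small) _.
  by rewrite ler_wpM2r // -natrM ler_nat; lia.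
(* The greedy bound allows [tau./2.+1] bidders. Serving only that many of [J] costs a factor of at
   most [2 * tau], since [#|J| <= tau ^ 2]. *)
have /card_geqP[s [us ss sJ]] : (tau./2.+1 <= #|J|)%N by lia.
have cS : #|[set i in s]| = tau./2.+1 by rewrite cardsE (card_uniqP us).
have hs : theta * (tau./2.+1)%:R <= 8 * B.
  rewrite -cS; apply: served; last by rewrite cS; lia.
  by apply/subsetP => i; rewrite inE => /sJ.
have : theta * #|J|%:R <= theta * (tau./2.+1 * (2 * tau))%:R.
  by rewrite ler_wpM2l // ler_nat; nia.
move=> /le_trans; apply; rewrite natrM mulrA.
apply: le_trans (ler_wpM2r _ hs) _; first by rewrite ler0n.
by rewrite natrM; lra.
Qed.

(** The three groups of bidders cover [I], and [22 = 2 + 4 + 16]. *)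
Lemma sharing_bound : theta * #|I|%:R <= 22 * tau%:R * B.
Proof.
have [th0|th0] := ltP theta 0.
  apply: (@le_trans _ _ 0); first by rewrite mulr_le0_ge0 ?ler0n // ltW.
  by rewrite !mulr_ge0.
have := small_demand_bound; have := small_packing_bound; have := large_packing_bound.
set J1 := [set _ in _ | _]; set J2 := [set _ in _ | _]; set J3 := [set _ in _ | _].
have : theta * #|I|%:R <= theta * (#|J1| + #|J2| + #|J3|)%:R.
  rewrite ler_wpM2l // ler_nat.
  apply: leq_trans (_ : #|J1 :|: J2 :|: J3| <= _)%N.
    apply/subset_leq_card/subsetP => i iI; rewrite !inE iI /=.
    by case: (leqP #|D i| tau); case: (leqP #|P i| tau); rewrite ?orbT.
  apply: leq_trans (leq_card_setU _ _) _; rewrite leq_add2r.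
  exact: leq_card_setU.
by rewrite !natrD !mulrDr; lra.
Qed.

End Sharing.

(** * Messages and bids *)

Section Logarithm.
Variable R : realType.

(** The successor makes the value at an exact power [2 ^ b] equal to [b + 1]. Below 1 the value is
    0. *)
Definition ceil_log2 (x : R) : nat := up_log 2 (Num.truncn x).+1.

Lemma ceil_log2_ge (x : R) : x <= 2 ^+ ceil_log2 x.
Proof.
apply: ltW; apply: lt_le_trans (truncnS_gt x) _.
by rewrite -natrX ler_nat up_logP.
Qed.

Lemma ceil_log2_le (x : R) (b : nat) : x <= 2 ^+ b -> (ceil_log2 x <= b.+1)%N.
Proof.
move=> xb; apply: up_log_min => //.
have : (Num.truncn x <= 2 ^ b)%N by rewrite -(@natrK R (2 ^ b)) natrX le_truncn.
by have := expn_gt0 2 b; rewrite expnS; lia.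
Qed.

Lemma ceil_log2_le_double (x : R) : 1 <= x -> 2 ^+ ceil_log2 x <= 2 * x.
Proof.
move=> x1; have x0 : 0 <= x by apply: le_trans x1.
have t0 : (0 < Num.truncn x)%N by rewrite truncn_gt0.
have := @up_log_gtn 2 (Num.truncn x).+1 isT t0.
have := up_log_gt0 2 (Num.truncn x).+1; rewrite /= ltnS t0 -/(ceil_log2 x).
case: (ceil_log2 x) => // l _; rewrite ltnS exprS /= => h.
rewrite ler_wpM2l //; apply: (@le_trans _ _ (Num.truncn x)%:R).
  by rewrite -natrX ler_nat.
by rewrite truncn_le.
Qed.

Lemma exists_dyadic_price (s q : R) (E : nat) :
    0 < q -> q <= s -> s <= 2 ^+ E * q ->
  exists2 e, (e <= E)%N & s / 2 ^+ e <= q <= 2 * (s / 2 ^+ e).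
Proof.
move=> q0 qs; elim: E => [|E IH].
  by rewrite mul1r => sq; exists 0%N => //; rewrite divr1 sq; lra.
have [/IH[e eE he] _|lt_s le_s] := leP s (2 ^+ E * q).
  by exists e => //; apply: leqW.
exists E.+1 => //; rewrite ler_pdivrMr ?exprn_gt0 // mulrC le_s /=.
rewrite mulrA exprS -mulf_div divff ?pnatr_eq0 // mul1r.
by rewrite ler_pdivlMr ?exprn_gt0 // mulrC ltW.
Qed.

End Logarithm.

(** Unary code closed by [false] is self-delimiting, so the planner can split a message without
    knowing the lengths of its fields. *)
Definition unary_decode (s : seq bool) : nat * seq bool :=
  (find negb s, drop (find negb s).+1 s).

Lemma unary_decodeK N s : unary_decode (nseq N true ++ false :: s) = (N, s).
Proof.
have f : find negb (nseq N true ++ false :: s) = N by elim: N => //= N ->.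
by rewrite /unary_decode f; congr pair; elim: N {f} => //=; rewrite drop0.
Qed.

Section Bids.
Variables (R : realType) (m : nat).
Implicit Types v : {set 'I_m} -> R.

(** Halving the scale up to [3 * m + 2] times reaches every price that [exists_large_bundle] asks
    for. *)
Definition price_level := 'I_(3 * m + 4).
Definition bundle_index := (price_level * 'I_m * 'I_m)%type.

(** [2 ^+ ceil_log2 x] is within a factor 2 of [x] only for [x >= 1], so [N] first lifts a positive
    [v setT] to at least 1. If [v setT = 0], the convention that 0 has inverse 0 makes both
    exponents 0. *)
Definition magnitude_code v : nat * nat :=
  let N := ceil_log2 (v setT)^-1 in (N, ceil_log2 (v setT * 2 ^+ N)).

Definition scale (c : nat * nat) : R := 2 ^+ c.2 / 2 ^+ c.1.

Definition price (c : nat * nat) (e : price_level) : R := scale c / 2 ^+ e.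

(* Bundles of size k.+1, indexed by the items they contain; the index of an
   uncovered item gives the empty bundle. *)
Definition bundle v (c : bundle_index) : {set 'I_m} :=
  pblock (packing v (price (magnitude_code v) c.1.1) c.1.2.+1) c.2.

Definition bid_message v : seq bool :=
  nseq (magnitude_code v).1 true ++ false ::
  nseq (magnitude_code v).2 true ++ false ::
  [seq c.2 \in bundle v c.1 | c <- enum {: bundle_index * 'I_m}].

(** A maximum of additive functions, that is, an XOS valuation. *)
Definition bid_from (mc : nat * nat) (T : bundle_index -> {set 'I_m})
    (S : {set 'I_m}) : R :=
  \big[Num.max/0]_(c : bundle_index) (price mc c.1.1 * #|S :&: T c|%:R).

Definition message_bid (s : seq bool) : {set 'I_m} -> R :=
  let d1 := unary_decode s in let d2 := unary_decode d1.2 in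
  bid_from (d1.1, d2.1)
    (fun c => [set y | nth false d2.2 (index (c, y) (enum {: bundle_index * 'I_m}))]).

Definition bid v : {set 'I_m} -> R := bid_from (magnitude_code v) (bundle v).

Lemma message_bidK v S : message_bid (bid_message v) S = bid v S.
Proof.
rewrite /message_bid /bid_message !unary_decodeK /=.
apply: eq_bigr => c _; congr (_ * (#|pred_of_set (_ :&: _)|)%:R).
apply/setP => y; rewrite inE (nth_map (c, y)); last first.
  by rewrite index_mem mem_enum.
by rewrite nth_index ?mem_enum.
Qed.

(** The unary exponents are at most [b + 1] and [2 * (b + 1)], so with their two terminators they
    take at most [5 * (b + 1)] bits. The rest is one bit per price, size, index and item. *)
Lemma size_bid_message v b :
    subadditive_valuation v -> magnitude_bits b v ->
  (size (bid_message v) <= (5 + (3 * m + 4) * m ^ 3) * b.+1)%N.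
Proof.
move=> sv mv; rewrite /bid_message !size_cat /= !size_cat /= !size_nseq size_map.
rewrite -cardE !card_prod !card_ord /magnitude_code /=.
set N := ceil_log2 (v setT)^-1; set a := ceil_log2 _.
have hN : (N <= b.+1)%N.
  case: (mv setT) => [v0|/andP[v1 v2]]; apply: ceil_log2_le.
    by rewrite v0 invr0 exprn_ge0.
  rewrite invf_ple ?posrE ?exprn_gt0 //.
  by apply: lt_le_trans v1; rewrite invr_gt0 exprn_gt0.
have ha : (a <= (b + N).+1)%N.
  apply: ceil_log2_le; rewrite exprD ler_wpM2r ?exprn_ge0 //.
  by case: (mv setT) => [->|/andP[_ //]]; rewrite exprn_ge0.
have -> : ((3 * m + 4) * m * m * m = (3 * m + 4) * m ^ 3)%N.
  by rewrite !expnS expn0; lia.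
by move: (_ * m ^ 3)%N => C; nia.
Qed.

Lemma scale_bounds v : 0 < v setT ->
  v setT <= scale (magnitude_code v) <= 2 * v setT.
Proof.
move=> v0; rewrite /scale /magnitude_code /=; set N := ceil_log2 (v setT)^-1.
have N0 : (0 : R) < 2 ^+ N by rewrite exprn_gt0.
have N1 : 1 <= v setT * 2 ^+ N by rewrite -ler_pdivrMl // mulr1; apply: ceil_log2_ge.
apply/andP; split; first by rewrite ler_pdivlMr //; apply: ceil_log2_ge.
by rewrite ler_pdivrMr // -mulrA; apply: ceil_log2_le_double.
Qed.

Lemma scale_gt0 mc : 0 < scale mc.
Proof. by rewrite divr_gt0 ?exprn_gt0. Qed.

Lemma price_gt0 mc e : 0 < price mc e.
Proof. by rewrite divr_gt0 ?exprn_gt0 ?scale_gt0. Qed.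

Lemma bid_ge0 v S : 0 <= bid v S.
Proof. exact: bigmax_ge_id. Qed.

(** Density bounds the value of the part of [S] inside a reported bundle, and monotonicity passes to
    [S]. *)
Lemma bid_le v S : subadditive_valuation v -> bid v S <= v S.
Proof.
move=> sv; apply: bigmax_le => [|c _]; first exact: valuation_ge0.
have /denseP/(_ (S :&: bundle v c)) := dense_pblock_packing sv
  (price (magnitude_code v) c.1.1) c.1.2.+1 c.2.
move=> /(_ (subsetIr _ _)) /le_trans; apply.
by case: sv => -[_ h] _; apply: h; apply: subsetIl.
Qed.

Lemma bid_packing v (e : price_level) (k : nat) (T S : {set 'I_m}) :
    (0 < k <= m)%N -> T \in packing v (price (magnitude_code v) e) k ->
  price (magnitude_code v) e * #|S :&: T|%:R <= bid v S.
Proof.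
case: k => // k /andP[_ km] TP.
have /set0Pn[x xT] : T != set0 by rewrite -card_gt0 (card_packing TP).
have <- : bundle v (e, Ordinal km, x) = T.
  by apply: def_pblock TP xT; apply: trivIset_packing.
exact: (le_bigmax 0 (fun c : bundle_index =>
  price (magnitude_code v) c.1.1 * #|S :&: bundle v c|%:R) (e, Ordinal km, x)).
Qed.

(** A maximal packing by bundles of size 1 leaves fewer than one item of a dense singleton
    uncovered. *)
Lemma bid_item v (e : price_level) (x : 'I_m) :
    dense v (price (magnitude_code v) e) [set x] ->
  price (magnitude_code v) e <= bid v [set x].
Proof.
move=> /(card_setD_cover_packing (ltn0Sn 0)).
rewrite ltnS leqn0 cards_eq0 setD_eq0 sub1set => xc.
have m0 : (0 < 1 <= m)%N by apply: leq_ltn_trans (ltn_ord x).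
have := bid_packing [set x] m0 (pblock_mem xc).
by rewrite (setIidPl _) ?cards1 ?mulr1 // sub1set mem_pblock.
Qed.

Lemma uphalf_bounds (a b c : nat) : (a + b = c -> b < uphalf c ->
  (c <= 2 * uphalf c) && (c <= 2 * a))%N.
Proof. lia. Qed.

(** Gathers what [sharing_bound] assumes about a single bidder. *)
Definition large_bundle_spec v (O : {set 'I_m}) (c : R)
    (d : {set 'I_m} * R * {set {set 'I_m}} * nat) : Prop :=
  let: (D, p, P, k) := d in
  [/\ [/\ D \subset O, D != set0, 0 <= p & c <= 2 * (p * #|D|%:R)],
      forall x, x \in D -> p <= bid v [set x],
      trivIset P /\ (forall T, T \in P -> #|T| = k),
      (#|D| <= 2 * k)%N && (#|D| <= 2 * #|D :&: cover P|)%N &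
      forall T S, T \in P -> p * #|S :&: T|%:R <= bid v S].

(** [exists_dense] gives [D] with an exact price [q]. Rounding [q] down to the grid preserves
    density and costs the factor 2 of the specification; the bound on [v setT] keeps [q] within
    reach of the grid. *)
Lemma exists_large_bundle v (O : {set 'I_m}) :
    subadditive_valuation v -> 0 < v O -> v setT <= 2 * m%:R * v O ->
  exists d, large_bundle_spec v O (v O / harmonic R m) d.
Proof.
move=> sv vO0 vT.
have vE : v set0 = 0 by case: sv => -[].
have mono (S T : {set 'I_m}) : S \subset T -> v S <= v T by case: sv => -[_ h] _; apply: h.
have O0 : O != set0 by apply: contraTneq vO0 => ->; rewrite vE ltxx.
have Om : (#|O| <= m)%N by rewrite -[leqRHS]card_ord max_card.
have m0 : (0 < m)%N by apply: leq_trans Om; rewrite card_gt0.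
have H1 := harmonic_ge1 R m0; have Hm := harmonic_le_nat R m.
set H := harmonic R m in H1 Hm *; have H0 : 0 < H by apply: lt_le_trans H1.
have [|D [DO D0 dD]] := exists_dense sv (c := v O / H) O0.
  rewrite -mulrA ger_pMr // mulrC ler_pdivrMr // mul1r.
  exact: harmonic_homo.
have D1 : (0 < #|D|)%N by rewrite card_gt0.
have Dm : (#|D| <= m)%N by rewrite -[leqRHS]card_ord max_card.
have Dp : (0 : R) < #|D|%:R by rewrite ltr0n.
set q := v O / H / #|D|%:R in dD.
have q0 : 0 < q by rewrite !divr_gt0.
have vOq : v O = q * #|D|%:R * H by rewrite /q !divfK ?lt0r_neq0.
clearbody q H.
have qT : q <= v setT.
  apply: le_trans (mono D setT (subsetT _)); move/denseP: dD => /(_ D (subxx _)).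
  by apply: le_trans; rewrite ler_pMr // ler1n.
have /andP[s1 s2] := scale_bounds (lt_le_trans q0 qT).
have [|e eE /andP[pq qp]] :=
  exists_dyadic_price (E := (3 * m + 2)%N) q0 (le_trans qT s1).
  (* The scale is at most [2 * v setT <= 4 * m * v O = 4 * m * #|D| * H * q], and [m], [#|D|] and
     [H] are each at most [2 ^ m]. *)
  have mm : m%:R * #|D|%:R * H <= 2 ^+ m * 2 ^+ m * 2 ^+ m :> R.
    have m2 : m%:R <= 2 ^+ m :> R by rewrite -natrX ler_nat ltnW // ltn_expl.
    have D2 : #|D|%:R <= 2 ^+ m :> R by apply: le_trans m2; rewrite ler_nat.
    apply: ler_pM; [exact: mulr_ge0 | exact: ltW | | exact: le_trans Hm m2].
    by apply: ler_pM.
  have -> : 2 ^+ (3 * m + 2) = 4 * (2 ^+ m * 2 ^+ m * 2 ^+ m) :> R.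
    by rewrite exprD mulnC exprM [RHS]mulrC; congr (_ * _); rewrite ?exprS ?expr0; lra.
  apply: le_trans s2 _; apply: le_trans (_ : 2 * (2 * m%:R * v O) <= _).
    by rewrite ler_wpM2l.
  have -> : 2 * (2 * m%:R * v O) = 4 * (m%:R * #|D|%:R * H) * q by rewrite vOq; ring.
  by rewrite ler_wpM2r ?ler_wpM2l // ltW.
have eL : (e < 3 * m + 4)%N by rewrite addnS ltnS (leq_trans eE) // leq_add2l.
pose p := price (magnitude_code v) (Ordinal eL).
have dpD : dense v p D by apply: le_dense dD.
pose k := uphalf #|D|.
have k1 : (0 < k)%N by rewrite /k uphalf_gt0.
have km : (0 < k <= m)%N.
  by rewrite k1 /= (leq_trans _ Dm) // /k leq_uphalf_double -addnn leq_addr.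
exists (D, p, packing v p k, k); split.
- split => //; first exact: ltW (price_gt0 _ _).
  by rewrite vOq mulfK ?lt0r_neq0 // mulrA ler_wpM2r.
- move=> x xD; apply: bid_item => //; apply: sub_dense dpD.
  by rewrite sub1set.
- by split; [apply: trivIset_packing | move=> T; apply: card_packing].
- exact: uphalf_bounds (cardsID _ _) (card_setD_cover_packing k1 dpD).
- by move=> T S TP; apply: bid_packing km TP.
Qed.

End Bids.

(** * The algorithm and its ratio *)

Section Algorithm.
Variables (R : realType) (m n : nat).

Lemma is_allocation0 : is_allocation ([ffun=> set0] : {ffun 'I_n -> {set 'I_m}}).
Proof.
apply/forallP => i; apply/forallP => j; apply/implyP => _.
by rewrite !ffunE -setI_eq0 setI0.
Qed.

(** Serves twice: the planner applies it to the bids, and the analysis to the true valuations. *)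
Definition best_allocation (w : 'I_n -> {set 'I_m} -> R) :
    {ffun 'I_n -> {set 'I_m}} :=
  [arg max_(A > [ffun=> set0] | is_allocation A) welfare w A]%O.

Lemma best_allocationP w : is_allocation (best_allocation w) /\
  forall A, is_allocation A -> welfare w A <= welfare w (best_allocation w).
Proof.
rewrite /best_allocation.
by case: (@Order.TotalTheory.arg_maxP _ _ _ _ _ (welfare w) is_allocation0).
Qed.

Definition bundle_algorithm : simultaneous_algorithm R m n :=
  {| message := fun _ v => bid_message v;
     planner := fun t => best_allocation (fun i => @message_bid R m (t i));
     planner_allocation := fun t => proj1 (best_allocationP _) |}.

Variable v : 'I_n -> {set 'I_m} -> R.
Hypothesis subadd : forall i, subadditive_valuation (v i).

Let bids i := bid (v i).
Let B := welfare bids (outcome bundle_algorithm v).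

Lemma welfare_bids_le A : is_allocation A -> welfare bids A <= B.
Proof.
have E A' : welfare bids A' =
    welfare (fun i => @message_bid R m (bid_message (v i))) A'.
  by apply: eq_bigr => i _; rewrite message_bidK.
by move=> /(proj2 (best_allocationP _)); rewrite /B !E; apply.
Qed.

Lemma welfare_bids_outcome : B <= welfare v (outcome bundle_algorithm v).
Proof. by apply: ler_sum => i _; apply: bid_le. Qed.

Variables (tau : nat) (tau_gt0 : (0 < tau)%N) (m_le : (m <= tau ^ 3)%N).

Let O := best_allocation v.
Let W := welfare v O.
Let G := [set i | (0 < v i (O i)) && (v i setT <= 2 * m%:R * v i (O i))].

Let allocO : is_allocation O. Proof. exact: (proj1 (best_allocationP v)). Qed.

Let disjO i j : i != j -> [disjoint O i & O j].
Proof. by have /forallP/(_ i)/forallP/(_ j)/implyP := allocO; apply. Qed.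

Let W_ge0 : 0 <= W.
Proof. by apply: sumr_ge0 => i _; apply: valuation_ge0. Qed.

Let v0 i : v i set0 = 0. Proof. by case: (subadd i) => -[]. Qed.

Lemma OPT_le_best : OPT v <= W.
Proof. by apply: bigmax_le => // A; apply: (proj2 (best_allocationP v)). Qed.

Lemma valuation_setT_le i : v i setT <= W.
Proof.
pose A := [ffun j => if j == i then [set: 'I_m] else set0].
have aA : is_allocation A.
  apply/forallP => j; apply/forallP => k; apply/implyP => jk; rewrite !ffunE.
  case: (eqVneq j i) => [e|_]; last by rewrite -setI_eq0 set0I.
  case: (eqVneq k i) => [e'|_]; last by rewrite -setI_eq0 setI0.
  by rewrite e e' eqxx in jk.
apply: le_trans (proj2 (best_allocationP v) _ aA).
rewrite /welfare (bigD1 i) //= ffunE eqxx lerDl.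
by apply: sumr_ge0 => j _; apply: valuation_ge0.
Qed.

Lemma sum_card_best : (\sum_i #|O i| <= m)%N.
Proof.
have := @sum_card_disjoint _ _ [set: 'I_n] O [set: 'I_m] (fun i j _ _ => @disjO i j).
rewrite cardsT card_ord; apply: leq_trans.
by apply/eq_leq/eq_big => [i|i _];
   rewrite ?inE ?setIT.
Qed.

(* Bidders outside G are worth at most W / (2 m) each, and at most m bidders
   get any item. *)
Lemma welfare_le_good : W <= 2 * \sum_(i in G) v i (O i).
Proof.
have bad : \sum_(i | i \notin G) v i (O i) <= W / 2.
  have [m0|m0] := posnP m.
    rewrite big1 ?divr_ge0 // => i _; suff -> : O i = set0 by [].
    by apply/eqP; rewrite -cards_eq0 -leqn0 -m0 -[leqRHS]card_ord max_card.
  have m2 : 0 < 2 * m%:R :> R by rewrite mulr_gt0 ?ltr0n.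
  have Wm0 : 0 <= W / (2 * m%:R) by apply: divr_ge0; [exact: W_ge0 | exact: ltW].
  apply: (@le_trans _ _ (\sum_(i | i \notin G) W / (2 * m%:R) * #|O i|%:R)).
    apply: ler_sum => i; rewrite inE negb_and -leNgt -ltNge.
    have [->|Oi] := eqVneq (O i) set0; first by rewrite cards0 mulr0 v0 => _.
    have O1 : 1 <= #|O i|%:R :> R by rewrite ler1n card_gt0.
    have Wm : W / (2 * m%:R) <= W / (2 * m%:R) * #|O i|%:R.
      by rewrite ler_peMr.
    case/orP => h; first by apply: le_trans h (le_trans Wm0 Wm).
    apply: le_trans Wm; rewrite ler_pdivlMr // mulrC.
    exact: le_trans (ltW h) (valuation_setT_le i).
  rewrite -mulr_sumr -natr_sum.
  have : (\sum_(i | i \notin G) #|O i| <= m)%N.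
    apply: leq_trans sum_card_best; rewrite [leqRHS](bigID [in G]) /=.
    exact: leq_addl.
  rewrite -(ler_nat R) => /(ler_wpM2l Wm0)/le_trans; apply.
  by rewrite invfM mulrA divfK // pnatr_eq0 -lt0n.
have : W = \sum_(i in G) v i (O i) + \sum_(i | i \notin G) v i (O i).
  by rewrite /W /welfare (bigID [in G]).
by lra.
Qed.

Let H := harmonic R m.

(** For each threshold [theta = v j (O j) / H], [sharing_bound] limits the number of bidders of [G]
    that reach it; [sum_le_harmonic] combines the thresholds. [G] has at most [m] bidders, as each
    gets an item. *)
Lemma good_sum_le : \sum_(i in G) v i (O i) / H <= 22 * tau%:R * B * H.
Proof.
have B_ge0 : 0 <= B.
  apply: le_trans (welfare_bids_le is_allocation0).
  by apply: sumr_ge0 => i _; apply: bid_ge0.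
apply: le_trans (sum_le_harmonic _ _) _; last first.
- apply: ler_wpM2l; first by rewrite !mulr_ge0.
  apply: harmonic_homo; apply: leq_trans sum_card_best.
  rewrite (bigID [in G]) /= -sum1_card; apply: leq_trans (leq_addr _ _).
  apply: leq_sum => i; rewrite inE card_gt0 => /andP[h _].
  by apply: contraTneq h => ->; rewrite v0 ltxx.
- move=> j jG; set theta := v j (O j) / H; set I := [set i in G | _].
  (* A bidder of [I] meets the specification at its own level, hence also at the lower level
     [theta]. Outside [I] the data are dummies. *)
  have /fin_all_exists[d hd] i : exists d,
      i \in I -> large_bundle_spec (v i) (O i) theta d.
    have [iI|_] := boolP (i \in I); last by exists (set0, 0, set0, 0%N).
    move: (iI); rewrite !inE => /andP[/andP[h1 h2] h3].
    have [[[[D p] P] k] hd] := exists_large_bundle (subadd i) h1 h2.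
    exists (D, p, P, k) => _; case: hd => -[? ? ? h] *.
    by split => //; split => //; apply: le_trans h.
  apply: (@sharing_bound _ _ _ bids B _ welfare_bids_le theta tau I
    (fun i => (d i).1.1.1) (fun i => (d i).1.1.2) (fun i => (d i).1.2)
    (fun i => (d i).2)) => //.
  + by move=> i S; apply: bid_ge0.
  + move=> i k iI kI ik; have := hd i iI; have := hd k kI.
    case: (d i) => [[[D p] P] ?]; case: (d k) => [[[D' p'] P'] ?].
    move=> [[sD' _ _ _] _ _ _ _] [[sD _ _ _] _ _ _ _] /=.
    exact: disjointWl sD (disjointWr sD' (disjO ik)).
  + by move=> i iI; have := hd i iI; case: (d i) => [[[D p] P] k] [[]].
  + by move=> i iI; have := hd i iI; case: (d i) => [[[D p] P] k] [[]].
  + by move=> i iI; have := hd i iI; case: (d i) => [[[D p] P] k] [[]].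
  + by move=> i x iI; have := hd i iI; case: (d i) => [[[D p] P] k] [_ h _ _ _] /h.
  + by move=> i iI; have := hd i iI; case: (d i) => [[[D p] P] k] [_ _ []].
  + by move=> i T iI; have := hd i iI; case: (d i) => [[[D p] P] k] [_ _ [_ h] _ _] /h.
  + by move=> i iI; have := hd i iI; case: (d i) => [[[D p] P] k] [_ _ _ /andP[]].
  + by move=> i iI; have := hd i iI; case: (d i) => [[[D p] P] k] [_ _ _ /andP[]].
  + by move=> i T S iI; have := hd i iI; case: (d i) => [[[D p] P] k] [_ _ _ _ h] /h.
- move=> j _; apply: divr_ge0; first exact: valuation_ge0.
  exact: harmonic_ge0.
Qed.

(** One factor [H] is lost to the dense parts and one to the sum over thresholds, and [44 = 2 * 22].
    Using [1 + H] keeps the ratio positive for [m = 0]. *)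
Lemma OPT_le_outcome :
  OPT v <= 44 * tau%:R * (1 + H) ^+ 2 * welfare v (outcome bundle_algorithm v).
Proof.
have H0 : 0 <= H := harmonic_ge0 R m.
have B0 : 0 <= B.
  apply: le_trans (welfare_bids_le is_allocation0).
  by apply: sumr_ge0 => i _; apply: bid_ge0.
apply: le_trans OPT_le_best _; apply: le_trans welfare_le_good _.
have -> : \sum_(i in G) v i (O i) = (\sum_(i in G) v i (O i) / H) * H.
  (* [H] vanishes only for [m = 0], where all bundles are empty and both sides are 0. *)
  rewrite -mulr_suml; have [m0|m0] := posnP m; last first.
    by rewrite divfK // gt_eqF // (lt_le_trans ltr01 (harmonic_ge1 R m0)).
  rewrite big1 ?mul0r // => i; rewrite inE => /andP[]; suff -> : O i = set0.
    by rewrite v0 ltxx.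
  by apply/eqP; rewrite -cards_eq0 -leqn0 -m0 -[leqRHS]card_ord max_card.
apply: le_trans (_ : 44 * tau%:R * H ^+ 2 * B <= _).
  have := ler_wpM2r H0 good_sum_le; rewrite expr2; lra.
apply: ler_pM; rewrite ?mulr_ge0 ?exprn_ge0 //; last exact: welfare_bids_outcome.
by rewrite ler_wpM2l ?mulr_ge0 // ler_pXn2r ?nnegrE ?addr_ge0 // lerDr.
Qed.

End Algorithm.

(** * Rounded cube roots and the final ratio *)

Definition cbrt_ceil (R : realType) (m : nat) : nat :=
  (Num.truncn ((m%:R : R) `^ (1 / 3))).+1.

Lemma cbrt_ceil_ge (R : realType) (m : nat) : (m <= cbrt_ceil R m ^ 3)%N.
Proof.
rewrite -(ler_nat R) natrX.
have h : (m%:R : R) = ((m%:R : R) `^ (1 / 3)) ^+ 3.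
  rewrite -powR_mulrn ?powR_ge0 // -powRrM.
  by rewrite (_ : 1 / 3 * 3%:R = 1) ?powRr1 //; field.
rewrite {1}h ler_pXn2r ?nnegrE ?powR_ge0 //.
exact: ltW (truncnS_gt _).
Qed.

(** For [m > 0] the cube root is at least 1, which absorbs the successor in [cbrt_ceil]. *)
Lemma cbrt_ceil_le (R : realType) (m : nat) :
  (0 < m)%N -> (cbrt_ceil R m)%:R <= 2 * (m%:R : R) `^ (1 / 3).
Proof.
move=> m0; have h1 : 1 <= (m%:R : R) `^ (1 / 3).
  have e : (1 : R) `^ (1 / 3) = 1 by rewrite powR1.
  rewrite -[leLHS]e; apply: ge0_ler_powR; rewrite ?nnegrE ?ler1n //; lra.
have h2 : (Num.truncn ((m%:R : R) `^ (1 / 3)))%:R <= (m%:R : R) `^ (1 / 3).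
  by rewrite truncn_le powR_ge0.
by rewrite /cbrt_ceil -[leLHS]natr1; lra.
Qed.

Theorem theorem6p9 (R : realType) :
  exists (c : nat -> R) (L : nat -> nat -> nat),
    softO c (fun m => m%:R `^ (1 / 3)) /\
    polynomially_bounded L /\
    forall m n : nat, exists alg : simultaneous_algorithm R m n,
      sends_bits alg (L m n) /\
      subadditive_approximation_ratio alg (c m).
Proof.
exists (fun m => 44 * (cbrt_ceil R m)%:R * (1 + harmonic R m) ^+ 2).
exists (fun m _ => 5 + (3 * m + 4) * m ^ 3)%N.
split; [|split].
(* The 2 comes from [cbrt_ceil_le], and 25 from [1 + harmonic R m <= 2 + ln m <= 5 * ln m], where
   [m >= 2] ensures [ln m >= 1 / 2]. *)
- exists (44 * 2 * 25), 2%N, 2%N => m m2.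
  have m0 : (0 < m)%N by apply: leq_trans m2.
  rewrite ger0_norm ?mulr_ge0 ?exprn_ge0 ?addr_ge0 ?harmonic_ge0 //.
  rewrite ger0_norm ?powR_ge0 //.
  have h : (1 + harmonic R m) ^+ 2 <= 25 * ln (m%:R : R) ^+ 2.
    have -> : 25 * ln (m%:R : R) ^+ 2 = (5 * ln (m%:R : R)) ^+ 2 by ring.
    have l2 := ln_ge_half R m2.
    rewrite ler_pXn2r ?nnegrE ?addr_ge0 ?harmonic_ge0 //; last by lra.
    by have := harmonic_le_ln R m0; lra.
  have -> : 44 * 2 * 25 * m%:R `^ (1 / 3) * ln (m%:R : R) ^+ 2
    = 44 * (2 * m%:R `^ (1 / 3)) * (25 * ln m%:R ^+ 2) by ring.
  apply: ler_pM; rewrite ?mulr_ge0 ?exprn_ge0 ?addr_ge0 ?harmonic_ge0 //.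
  by rewrite ler_wpM2l // cbrt_ceil_le.
- exists 12%N, 4%N => m n.
  have : (5 + (3 * m + 4) * m ^ 3 <= 12 * m.+1 ^ 4)%N.
    by rewrite !expnS expn0; nia.
  move=> /leq_trans; apply; rewrite leq_mul2l /= leq_exp2r //; lia.
- move=> m n; exists (bundle_algorithm R m n); split.
    by move=> i v b; apply: size_bid_message.
  split.
    by rewrite !mulr_gt0 ?ltr0n ?exprn_gt0 // ltr_wpDr ?harmonic_ge0.
  move=> v sv; rewrite ler_pdivrMr; last first.
    by rewrite !mulr_gt0 ?ltr0n ?exprn_gt0 // ltr_wpDr ?harmonic_ge0.
  by rewrite mulrC; apply: OPT_le_outcome => //; apply: cbrt_ceil_ge.
Qed.
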